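(* Let $\mathbf{A}_1\in\mathbb{H}^{m\times n}_{r_1}$, $\mathbf{B}_2\in\mathbb{H}^{q\times s}_{r_2}$, $\mathbf{C}\in\mathbb{H}^{m\times s}$, and let $\mathbf{X}_1=\mathbf{A}_1^\dagger\mathbf{C}=(x^{(1)}_{ij})\in\mathbb{H}^{n\times s}$ and $\mathbf{X}_2=\mathbf{C}\mathbf{B}_2^\dagger-\mathbf{Q}_{A_1}\mathbf{C}\mathbf{B}_2^\dagger=(x^{(2)}_{gf})\in\mathbb{H}^{m\times q}$. Let $\mathbf{c}^{(1)}_{.j}$ be the $j$th column of $\mathbf{C}_1=\mathbf{A}_1^*\mathbf{C}$, $\mathbf{c}^{(2)}_{g.}$ the $g$th row of $\mathbf{C}_2=\mathbf{C}\mathbf{B}_2^*$, and $\ddot{\mathbf{a}}^{(1)}_{g.}$ the $g$th row of $\mathbf{A}_1\mathbf{A}_1^*$. Then $$x^{(1)}_{ij}=\frac{\sum_{\beta\in J_{r_1,n}\{i\}}\mathrm{cdet}_i\big((\mathbf{A}_1^*\mathbf{A}_1)_{.i}(\mathbf{c}^{(1)}_{.j})\big)^\beta_\beta}{\sum_{\beta\in J_{r_1,n}}|\mathbf{A}_1^*\mathbf{A}_1|^\beta_\beta},$$ $$x^{(2)}_{gf}=\frac{\sum_{\alpha\in I_{r_2,q}\{f\}}\mathrm{rdet}_f\big((\mathbf{B}_2\mathbf{B}_2^* )_{f.}(\mathbf{c}^{(2)}_{g.})\big)^\alpha_\alpha}{\sum_{\alpha\in I_{r_2,q}}|\mathbf{B}_2\mathbf{B}_2^*|^\alpha_\alpha}-\frac{\sum_{l=1}^m\sum_{\alpha\in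 I_{r_1,m}\{l\}}\mathrm{rdet}_l\big((\mathbf{A}_1\mathbf{A}_1^* )_{l.}(\ddot{\mathbf{a}}^{(1)}_{g.})\big)^\alpha_\alpha\sum_{\alpha\in I_{r_2,q}\{f\}}\mathrm{rdet}_f\big((\mathbf{B}_2\mathbf{B}_2^* )_{f.}(\mathbf{c}^{(2)}_{l.})\big)^\alpha_\alpha}{\sum_{\alpha\in I_{r_1,m}}|\mathbf{A}_1\mathbf{A}_1^*|^\alpha_\alpha\sum_{\alpha\in I_{r_2,q}}|\mathbf{B}_2\mathbf{B}_2^*|^\alpha_\alpha}.$$
   Context: $\mathbb{H}$ is the skew field of real quaternions; $\mathbb{H}^{m\times n}$ is the set of $m\times n$ matrices over $\mathbb{H}$ and $\mathbb{H}^{m\times n}_r$ the subset of those of rank $r$. $\mathbf{A}^*$ is the conjugate transpose and $\mathbf{A}^\dagger$ the Moore–Penrose inverse (the unique $\mathbf{X}$ with $\mathbf{AXA}=\mathbf{A}$, $\mathbf{XAX}=\mathbf{X}$, $(\mathbf{AX})^*=\mathbf{AX}$, $(\mathbf{XA})^*=\mathbf{XA}$). $\mathbf{Q}_A=\mathbf{A}\mathbf{A}^\dagger$. For a matrix $\mathbf{F}$, $\mathbf{F}_{.j}(\mathbf{b})$ (resp. $\mathbf{F}_{i.}(\mathbf{b})$) is $\mathbf{F}$ with its $j$th column (resp. $i$th row) replaced by the column (resp. row) $\mathbf{b}$. Row/column determinants: for $\mathbf{F}=(a_{ij})\in\mathbb{H}^{n\times n}$, $\mathrm{rdet}_i\mathbf{F}=\sum_{\sigma\in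 S_n}(-1)^{n-r}(a_{i\,i_{k_1}}a_{i_{k_1}i_{k_1+1}}\cdots a_{i_{k_1+l_1}i})\cdots(a_{i_{k_r}i_{k_r+1}}\cdots a_{i_{k_r+l_r}i_{k_r}})$, where $\sigma=(i\,i_{k_1}\,i_{k_1+1}\cdots i_{k_1+l_1})(i_{k_2}\cdots i_{k_2+l_2})\cdots(i_{k_r}\cdots i_{k_r+l_r})$ is the decomposition of $\sigma$ into $r$ disjoint cycles (fixed points included) with $i_{k_2}<\cdots<i_{k_r}$ and $i_{k_t}<i_{k_t+s}$ for $t=2,\dots,r$, $s=1,\dots,l_t$; and $\mathrm{cdet}_j\mathbf{F}=\sum_{\tau\in S_n}(-1)^{n-r}(a_{j_{k_r}j_{k_r+l_r}}\cdots a_{j_{k_r+1}j_{k_r}})\cdots(a_{j\,j_{k_1+l_1}}\cdots a_{j_{k_1+1}j_{k_1}}a_{j_{k_1}j})$, where $\tau=(j_{k_r+l_r}\cdots j_{k_r+1}\,j_{k_r})\cdots(j_{k_2+l_2}\cdots j_{k_2})(j_{k_1+l_1}\cdots j_{k_1+1}\,j_{k_1}\,j)$ is the decomposition into $r$ disjoint cycles with $j_{k_2}<\cdots<j_{k_r}$ and $j_{k_t}<j_{k_t+s}$ for $t=2,\dots,r$, $s=1,\dots,l_t$. For Hermitian $\mathbf{F}$ all these coincide and are real; this value is $\det\mathbf{F}$. Index sets: $L_{k,n}$ is the set of strictly increasing sequences $\alpha=(\alpha_1<\cdots<\alpha_k)$ in $\{1,\dots,n\}$; $I_{k,m}\{i\}=\{\alpha\in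 L_{k,m}: i\in\alpha\}$, $J_{k,n}\{j\}=\{\beta\in L_{k,n}: j\in\beta\}$; sums over $J_{k,n}$ or $I_{k,m}$ without braces run over all of $L_{k,n}$, $L_{k,m}$. For a square $\mathbf{F}$, $\mathbf{F}^\alpha_\alpha$ is the principal submatrix with rows and columns indexed by $\alpha$; $\mathrm{cdet}_i(\mathbf{G})^\beta_\beta$ (resp. $\mathrm{rdet}_j(\mathbf{G})^\alpha_\alpha$) is the column (resp. row) determinant of the principal submatrix $\mathbf{G}^\beta_\beta$ taken at the column (resp. row) coming from index $i$ (resp. $j$); for Hermitian $\mathbf{F}$, $|\mathbf{F}|^\alpha_\alpha=\det\mathbf{F}^\alpha_\alpha$. *)

(* Defs.v *)
From HB Require Import structures.
From mathcomp Require Import all_boot all_order all_algebra all_fingroup.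
From mathcomp Require Import ring.
Set Implicit Arguments. Unset Strict Implicit. Unset Printing Implicit Defensive.
Import Order.TTheory GRing.Theory Num.Theory.
Local Open Scope ring_scope.

Section Quat.
Variable R : realFieldType.

Record quat := Quat { q0 : R; q1 : R; q2 : R; q3 : R }.

Definition quat_to (x : quat) := (q0 x, q1 x, q2 x, q3 x).
Definition quat_of (p : R * R * R * R) := let: (a, b, c, d) := p in Quat a b c d.
Lemma quat_toK : cancel quat_to quat_of. Proof. by case. Qed.

HB.instance Definition _ := Choice.copy quat (can_type quat_toK).

Definition qadd x y := Quat (q0 x + q0 y) (q1 x + q1 y) (q2 x + q2 y) (q3 x + q3 y).
Definition qopp x := Quat (- q0 x) (- q1 x) (- q2 x) (- q3 x).
Definition qzero := Quat 0 0 0 0.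
Definition qone := Quat 1 0 0 0.
(* Hamilton product: i^2 = j^2 = k^2 = ijk = -1 *)
Definition qmul x y := Quat
  (q0 x * q0 y - q1 x * q1 y - q2 x * q2 y - q3 x * q3 y)
  (q0 x * q1 y + q1 x * q0 y + q2 x * q3 y - q3 x * q2 y)
  (q0 x * q2 y - q1 x * q3 y + q2 x * q0 y + q3 x * q1 y)
  (q0 x * q3 y + q1 x * q2 y - q2 x * q1 y + q3 x * q0 y).

Lemma qaddA : associative qadd.
Proof. by case=> ? ? ? ?; case=> ? ? ? ?; case=> ? ? ? ?; rewrite /qadd /=; congr Quat; ring. Qed.
Lemma qaddC : commutative qadd.
Proof. by case=> ? ? ? ?; case=> ? ? ? ?; rewrite /qadd /=; congr Quat; ring. Qed.
Lemma qadd0 : left_id qzero qadd.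
Proof. by case=> ? ? ? ?; rewrite /qadd /=; congr Quat; ring. Qed.
Lemma qaddN : left_inverse qzero qopp qadd.
Proof. by case=> ? ? ? ?; rewrite /qadd /=; congr Quat; ring. Qed.

HB.instance Definition _ := GRing.isZmodule.Build quat qaddA qaddC qadd0 qaddN.

Lemma qmulA : associative qmul.
Proof. by case=> ? ? ? ?; case=> ? ? ? ?; case=> ? ? ? ?; rewrite /qmul /=; congr Quat; ring. Qed.
Lemma qmul1 : left_id qone qmul.
Proof. by case=> ? ? ? ?; rewrite /qmul /=; congr Quat; ring. Qed.
Lemma qmulr1 : right_id qone qmul.
Proof. by case=> ? ? ? ?; rewrite /qmul /=; congr Quat; ring. Qed.
Lemma qmulDl : left_distributive qmul qadd.
Proof. by case=> ? ? ? ?; case=> ? ? ? ?; case=> ? ? ? ?; rewrite /qmul /= /qadd /=; congr Quat; ring. Qed.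
Lemma qmulDr : right_distributive qmul qadd.
Proof. by case=> ? ? ? ?; case=> ? ? ? ?; case=> ? ? ? ?; rewrite /qmul /= /qadd /=; congr Quat; ring. Qed.
Lemma qone_neq0 : qone != 0.
Proof. by apply/eqP => -[] /eqP; rewrite oner_eq0. Qed.

HB.instance Definition _ :=
  GRing.Zmodule_isNzRing.Build quat qmulA qmul1 qmulr1 qmulDl qmulDr qone_neq0.

Definition qreal (a : R) := Quat a 0 0 0.
Definition qconj x := Quat (q0 x) (- q1 x) (- q2 x) (- q3 x).
(* inverse: conj(x) / |x|^2  (0 for x = 0) *)
Definition qinv x :=
  let d := q0 x ^+ 2 + q1 x ^+ 2 + q2 x ^+ 2 + q3 x ^+ 2 in
  Quat (q0 x / d) (- q1 x / d) (- q2 x / d) (- q3 x / d).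

End Quat.

Section QMat.
Variable R : realFieldType.
Local Notation H := (quat R).

Definition ctmx m n (A : 'M[H]_(m, n)) : 'M[H]_(n, m) := map_mx (@qconj R) A^T.

Definition is_MP m n (A : 'M[H]_(m, n)) (X : 'M[H]_(n, m)) : Prop :=
  [/\ A *m X *m A = A, X *m A *m X = X,
      ctmx (A *m X) = A *m X & ctmx (X *m A) = X *m A].

Definition col_indep m n (A : 'M[H]_(m, n)) (S : {set 'I_n}) : Prop :=
  forall v : 'cV[H]_n, (forall j, j \notin S -> v j 0 = 0) ->
    A *m v = 0 -> v = 0.

Definition has_rank m n (A : 'M[H]_(m, n)) (r : nat) : Prop :=
  (exists S : {set 'I_n}, #|S| = r /\ col_indep A S) /\
  (forall S : {set 'I_n}, col_indep A S -> (#|S| <= r)%N).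

Definition colrep m n (F : 'M[H]_(m, n)) (j : 'I_n) (b : 'cV[H]_m) : 'M[H]_(m, n) :=
  \matrix_(a, c) (if c == j then b a 0 else F a c).
Definition rowrep m n (F : 'M[H]_(m, n)) (i : 'I_m) (b : 'rV[H]_n) : 'M[H]_(m, n) :=
  \matrix_(a, c) (if a == i then b 0 c else F a c).

Definition cycprod k (F : 'M[H]_k) (s : 'S_k) (x : 'I_k) : H :=
  \prod_(t < #|porbit s x|) F (iter t s x) (iter t.+1 s x).

(* leading (= minimal) elements of the cycles of s not containing i,
   in increasing order *)
Definition other_mins k (s : 'S_k) (i : 'I_k) : seq 'I_k :=
  [seq x <- enum 'I_k | (x \notin porbit s i) &&
                        [forall y, (y \in porbit s x) ==> (x <= y)%N]].

Definition cyc_sign k (s : 'S_k) : H := (-1) ^+ (k - #|porbits s|).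

Definition rdet k (i : 'I_k) (F : 'M[H]_k) : H :=
  \sum_(s : 'S_k) cyc_sign s *
     (cycprod F s i * \prod_(x <- other_mins s i) cycprod F s x).

(* column determinant cdet_j: other cycles in decreasing order of their
   leading elements, then the cycle through j (ending with a_{j_{k1} j}) *)
Definition cdet k (j : 'I_k) (F : 'M[H]_k) : H :=
  \sum_(s : 'S_k) cyc_sign s *
     ((\prod_(x <- rev (other_mins s j)) cycprod F s x) * cycprod F s j).

(* determinant of a (Hermitian) matrix: rdet_i at any index (1 if empty) *)
Definition qdet k (F : 'M[H]_k) : H :=
  if [pick i : 'I_k] is Some i then rdet i F else 1.

Definition psubmx k (F : 'M[H]_k) (a : {set 'I_k}) : 'M[H]_#|a| :=
  \matrix_(u, v) F (enum_val u) (enum_val v).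

(* rdet_i (F)^a_a, cdet_i (F)^a_a : taken at the row/column coming from i
   (meaningful for i \in a) *)
Definition rdet_sub k (i : 'I_k) (F : 'M[H]_k) (a : {set 'I_k}) : H :=
  if [pick u : 'I_#|a| | enum_val u == i] is Some u then rdet u (psubmx F a) else 0.
Definition cdet_sub k (i : 'I_k) (F : 'M[H]_k) (a : {set 'I_k}) : H :=
  if [pick u : 'I_#|a| | enum_val u == i] is Some u then cdet u (psubmx F a) else 0.

Definition det_sub k (F : 'M[H]_k) (a : {set 'I_k}) : H := qdet (psubmx F a).

End QMat.

(* Main.v *)
Require Import Defs.
From HB Require Import structures.
From mathcomp Require Import all_boot all_order all_algebra all_fingroup.
From mathcomp Require Import reals.
From mathcomp Require Import boolp ring.
Import GRing.Theory Num.Theory.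
Set Implicit Arguments. Unset Strict Implicit. Unset Printing Implicit Defensive.
Local Open Scope ring_scope.

(** Expanding a column determinant along its i-th column gives left cofactors
L_a(i, j), sums over the permutations of the index set a that map j to i.
Removing j from the cycle through i yields the recursion
L_a(i, j) = - sum_l L_(a-j)(i, l) F(l, j) for i <> j, together with
L_a(i, i) = D(a - i).  If each cycle avoiding i is weighted by the real part
of its product, then D is real by construction; for Hermitian F the recursion
makes L_a Hermitian, and induction on a gives L_a F = D(a) I on a.  The
ordered (noncommutative) cofactors satisfy the same recursion, hence coincide
with the real-weighted ones.

Summing over all a of size m gives P_m F + P_(m+1) = e_m I, with P_m the sum
of cofactor matrices and e_m the sum of principal minors.  For F = A^* A and m
the largest index with e_m <> 0 this implies P_m A^* = e_m A^+, and the real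
part of the trace of P_m F = e_m A^+ A, namely m e_m, identifies m with the
rank of A.  The row statements follow by conjugate transposition. *)

(** * Quaternions and conjugate transposes *)

Section Quaternions.
Variable R : realFieldType.
Local Notation H := (quat R).
Implicit Types x y : H.

Lemma quat_eq x y :
  q0 x = q0 y -> q1 x = q1 y -> q2 x = q2 y -> q3 x = q3 y -> x = y.
Proof. by case: x y => ? ? ? ? [] ? ? ? ? /= -> -> -> ->. Qed.

Fact q0_additive : zmod_morphism (@q0 R). Proof. by []. Qed.
HB.instance Definition _ := GRing.isZmodMorphism.Build H R (@q0 R) q0_additive.

Fact qconj_additive : zmod_morphism (@qconj R).
Proof. by move=> x y; apply: quat_eq; rewrite //= opprD. Qed.
HB.instance Definition _ :=
  GRing.isZmodMorphism.Build H H (@qconj R) qconj_additive.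

Fact qreal_additive : zmod_morphism (@qreal R).
Proof. by move=> a b; apply: quat_eq; rewrite //= subrr. Qed.
HB.instance Definition _ :=
  GRing.isZmodMorphism.Build R H (@qreal R) qreal_additive.

Fact qreal_multiplicative : monoid_morphism (@qreal R).
Proof. by split=> // a b; apply: quat_eq => /=; ring. Qed.
HB.instance Definition _ :=
  GRing.isMonoidMorphism.Build R H (@qreal R) qreal_multiplicative.

Lemma qconjM x y : qconj (x * y) = qconj y * qconj x.
Proof. by apply: quat_eq => /=; ring. Qed.

Lemma qconjK : involutive (@qconj R).
Proof. by move=> x; apply: quat_eq; rewrite //= opprK. Qed.

Lemma qconj_real a : qconj (qreal a : H) = qreal a.
Proof. by apply: quat_eq; rewrite //= oppr0. Qed.

Lemma qconj_prod (I : Type) (r : seq I) (f : I -> H) :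
  qconj (\prod_(i <- r) f i) = \prod_(i <- rev r) qconj (f i).
Proof.
elim: r => [|i r IHr]; first by rewrite !big_nil (qconj_real 1).
by rewrite rev_cons big_rcons big_cons qconjM IHr.
Qed.

Lemma qconj_prod_ord m (f : nat -> H) :
  qconj (\prod_(n < m) f n) = \prod_(n < m) qconj (f (m - n.+1)%N).
Proof.
elim: m => [|m IHm]; first by rewrite !big_ord0 (qconj_real 1).
by rewrite big_ord_recr big_ord_recl qconjM IHm subn1.
Qed.

(** The real part behaves like a trace: products under it may be rotated, both along a cycle of a
    permutation and for matrices under [\tr]. *)
Lemma q0M x y : q0 (x * y) = q0 (y * x).
Proof. by rewrite /=; ring. Qed.

Lemma q0_realM a x : q0 (qreal a * x) = a * q0 x.
Proof. by rewrite /=; ring. Qed.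

Lemma qreal_comm a x : qreal a * x = x * qreal a.
Proof. by apply: quat_eq => /=; ring. Qed.

Lemma qreal_inj : injective (@qreal R).
Proof. by move=> a b []. Qed.

Lemma qconj_fixed x : qconj x = x -> x = qreal (q0 x).
Proof.
have N0 (a : R) : - a = a -> a = 0.
  move=> /eqP; rewrite -subr_eq0 -opprD oppr_eq0 -mulr2n mulrn_eq0.
  by move=> /eqP.
by case: x => a b c d [] /N0-> /N0-> /N0->.
Qed.

Lemma qinv_real a : qinv (qreal a : H) = qreal a^-1.
Proof.
rewrite /qinv /= !expr0n !addr0 oppr0 mul0r; congr Quat.
have [->|a0] := eqVneq a 0; first by rewrite mul0r invr0.
by rewrite expr2 invfM mulrA mulfV // mul1r.
Qed.

Lemma qmulV x : x != 0 -> x * qinv x = 1.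
Proof.
move=> x0; set d := q0 x ^+ 2 + q1 x ^+ 2 + q2 x ^+ 2 + q3 x ^+ 2.
have d0 : d != 0.
  apply: contraNneq x0 => /eqP; rewrite !paddr_eq0 ?addr_ge0 ?sqr_ge0 //.
  rewrite !sqrf_eq0 -!andbA => /and4P[/eqP ? /eqP ? /eqP ? /eqP ?].
  exact/eqP/quat_eq.
by apply: quat_eq; rewrite /= -/d; move: d0; rewrite /d => d0; field.
Qed.

Lemma sum_normsq_eq0 (I : finType) (f : I -> H) :
  \sum_i f i * qconj (f i) = 0 -> forall i, f i = 0.
Proof.
move=> /(congr1 (@q0 R)); rewrite raddf_sum /= => /eqP.
rewrite psumr_eq0 => [/allP f0 i|i _]; last first.
  by rewrite !mulrN !opprK !addr_ge0 // -expr2 sqr_ge0.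
have := f0 i (mem_index_enum i); rewrite /= !mulrN !opprK -!expr2.
rewrite !paddr_eq0 ?addr_ge0 ?sqr_ge0 //.
rewrite !sqrf_eq0 -!andbA => /and4P[/eqP ? /eqP ? /eqP ? /eqP ?].
exact: quat_eq.
Qed.

End Quaternions.

Section ConjugateTranspose.
Variable R : realFieldType.
Local Notation H := (quat R).

Lemma ctmxE m n (A : 'M[H]_(m, n)) i j : ctmx A i j = qconj (A j i).
Proof. by rewrite !mxE. Qed.

Lemma ctmxK m n (A : 'M[H]_(m, n)) : ctmx (ctmx A) = A.
Proof. by apply/matrixP=> i j; rewrite !ctmxE qconjK. Qed.

Lemma ctmxM m n p (A : 'M[H]_(m, n)) (B : 'M[H]_(n, p)) :
  ctmx (A *m B) = ctmx B *m ctmx A.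
Proof.
apply/matrixP=> i j; rewrite ctmxE !mxE raddf_sum; apply: eq_bigr => k _.
by rewrite !ctmxE /= qconjM.
Qed.

(** Each diagonal entry of [A *m ctmx A] is a sum of squared norms, which vanishes only if every
    summand does. *)
Lemma mulmx_ctmx_eq0 m n (A : 'M[H]_(m, n)) : A *m ctmx A = 0 -> A = 0.
Proof.
move=> /matrixP A0; apply/matrixP=> i j; rewrite [RHS]mxE.
have := A0 i i; rewrite [RHS]mxE mxE => AA0.
apply: (@sum_normsq_eq0 _ _ (A i)); rewrite -[RHS]AA0.
by apply: eq_bigr => k _; rewrite ctmxE.
Qed.

Lemma q0_mxtraceM m n (A : 'M[H]_(m, n)) (B : 'M[H]_(n, m)) :
  q0 (\tr (A *m B)) = q0 (\tr (B *m A)).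
Proof.
rewrite /mxtrace !raddf_sum.
under eq_bigr do rewrite mxE raddf_sum.
under [RHS]eq_bigr do rewrite mxE raddf_sum.
by rewrite exchange_big; do 2!apply: eq_bigr => ? _; apply: q0M.
Qed.

Lemma is_MP_ctmx m n (A : 'M[H]_(m, n)) (X : 'M[H]_(n, m)) :
  is_MP A X -> is_MP (ctmx A) (ctmx X).
Proof.
move=> [AXA XAX AXs XAs]; split; rewrite -?ctmxM ?ctmxK.
- by rewrite mulmxA AXA.
- by rewrite mulmxA XAX.
- by rewrite XAs.
- by rewrite AXs.
Qed.

End ConjugateTranspose.

(** * Cofactors as sums over permutations *)

Section PermutationCycles.
Local Open Scope group_scope.
Variable T : finType.
Implicit Types (s t : {perm T}) (x y : T) (a : {set T}).

Lemma iter_porbit_pred s x : iter #|porbit s x|.-1 s x = s^-1 x.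
Proof.
apply: (@perm_inj _ s); rewrite permKV -iterS prednK ?iter_porbit //.
by rewrite lt0n card_porbit_neq0.
Qed.

Lemma porbit_sub s a x : perm_on a s -> x \in a -> porbit s x \subset a.
Proof.
move=> a_s ax; apply/subsetP=> _ /porbitP[n ->].
by elim: n => [|n IHn]; rewrite ?perm1 // expgSr permM perm_closed.
Qed.

Lemma porbit_step s x y : (s y \in porbit s x) = (y \in porbit s x).
Proof. by rewrite -!eq_porbit_mem -[s y]/((s ^+ 1) y) porbit_perm. Qed.

Lemma eq_porbit_iter s t x :
  (forall n, iter n s x = iter n t x) -> porbit s x = porbit t x.
Proof.
move=> eq_st; apply/setP=> y.
by apply/porbitP/porbitP=> -[n ->]; exists n; rewrite !permX.
Qed.

Lemma eq_in_iter_perm s t a x : {in a, s =1 t} ->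
  (forall y, y \in a -> t y \in a) -> x \in a ->
  forall n, iter n s x = iter n t x.
Proof.
move=> eq_st at_a ax n.
suff [] : iter n s x = iter n t x /\ iter n t x \in a by [].
elim: n => //= n [-> IHn]; split; last exact: at_a.
exact: eq_st.
Qed.

(* [t] is [s] with the fixed point [y] inserted in the cycle of [x], just
   before [x]. *)
Section InsertInCycle.
Variables (s : {perm T}) (x y : T).
Hypotheses (xy : x != y) (sy : s y = y).
Let t := s * tperm x y.
Let m := #|porbit s x|.

Let notin_cycle n : iter n s x != y.
Proof.
apply/negP=> /eqP; elim: n => [/eqP|n IHn]; first by rewrite (negPf xy).
by rewrite iterS -{1}sy => /perm_inj.
Qed.

Lemma iter_insert n : (n < m)%N -> iter n t x = iter n s x.
Proof.
elim: n => //= n IHn lt_n; rewrite IHn; last exact: ltnW.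
rewrite permM tpermD //; last by rewrite eq_sym (notin_cycle n.+1).
(* Since [y] is excluded, [tperm x y] could act here only on [x], and returning to [x] before [m]
   steps would repeat an entry of its cycle. *)
have := uniq_traject_porbit s x; rewrite -/m.
case: m lt_n => // k lt_n /= /andP[+ _]; apply: contraNneq => eq_x.
by apply/trajectP; exists n; rewrite // -iterSr.
Qed.

Lemma iter_insert_last : iter m t x = y.
Proof.
rewrite -[m]prednK ?lt0n ?card_porbit_neq0 //= iter_insert; last first.
  by rewrite ltn_predL lt0n card_porbit_neq0.
by rewrite iter_porbit_pred permM permKV tpermL.
Qed.

Lemma insert_last : t y = x.
Proof. by rewrite permM sy tpermR. Qed.

Lemma porbit_insert : porbit t x = y |: porbit s x.
Proof.
apply/setP=> z; rewrite in_setU1 (porbit_traject s) -/m; apply/porbitP/idP.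
  move=> [n ->]; rewrite permX.
  (* The cycle of [t] has length [m.+1]: [m] steps lead from [x] to [y], one more returns to [x]. *)
  have -> : iter n t x = iter (n %% m.+1) t x.
    rewrite {1}(divn_eq n m.+1) addnC iterD; congr iter.
    elim: (n %/ m.+1)%N => // q IHq.
    by rewrite mulSn addnC iterD iterS iter_insert_last insert_last.
  have := ltn_pmod n (ltn0Sn m); rewrite ltnS leq_eqVlt => /predU1P[->|lt_m].
    by rewrite iter_insert_last eqxx.
  rewrite iter_insert //; apply/orP; right.
  by apply/trajectP; exists (n %% m.+1)%N.
move=> /predU1P[->|/trajectP[n lt_n ->]].
  by exists m; rewrite permX iter_insert_last.
by exists n; rewrite permX iter_insert.
Qed.

Lemma notin_porbit_insert : y \notin porbit s x.
Proof.
by apply/porbitP=> -[n yE]; move: (notin_cycle n); rewrite -permX -yE eqxx.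
Qed.

Lemma eq_insert z : z \notin porbit t x -> t z = s z.
Proof.
rewrite porbit_insert in_setU1 negb_or => /andP[zy zs]; rewrite permM tpermD //.
  apply: contraNneq zs => x_sz; rewrite porbit_sym x_sz.
  by have := mem_porbit s 1 z; rewrite expg1.
by rewrite -{1}sy (inj_eq perm_inj) eq_sym.
Qed.

(** Matches the permutations of [a] sending [y] to [x] with those of [a :\ y], the reindexing behind
    the cofactor recursion. *)
Lemma perm_on_insert a : x \in a -> y \in a -> perm_on a t = perm_on (a :\ y) s.
Proof.
move=> ax ay; apply/idP/idP => [a_t|a_s].
  have a_s : perm_on a s.
    have -> : s = t * tperm x y by rewrite -mulgA tperm2 mulg1.
    apply: perm_onM => //; apply: subset_trans (tperm_on x y) _.
    by apply/subsetP=> z /set2P[] ->.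
  apply/subsetP=> z nz; rewrite in_setD1 (subsetP a_s _ nz) andbT.
  by apply: contraTneq nz => ->; rewrite inE sy eqxx.
apply: perm_onM; first exact: subset_trans a_s (subsetDl _ _).
apply: subset_trans (tperm_on x y) _.
by apply/subsetP=> z /set2P[] ->.
Qed.

End InsertInCycle.

End PermutationCycles.

(** * Weighted cofactors and their recursion *)

Section Cofactors.
Variables (R : realFieldType) (k : nat) (F : 'M[quat R]_k).
Local Notation H := (quat R).
Implicit Types (s t : 'S_k) (a b : {set 'I_k}) (i j x : 'I_k).

Definition openprod s x : H :=
  \prod_(t < #|porbit s x|.-1) F (iter t s x) (iter t.+1 s x).

Lemma cycprodE s x : cycprod F s x = openprod s x * F (s^-1%g x) x.
Proof.
rewrite /cycprod /openprod -(iter_porbit_pred s x).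
case def_m: #|porbit s x| => [|m].
  by have := card_porbit_neq0 s x; rewrite def_m.
rewrite big_ord_recr /=; congr (_ * F _ _).
by rewrite -iterS -def_m iter_porbit.
Qed.

(* On a set [a] stable under [s]: the leading elements of the cycles in [a]. *)
Definition cycle_mins a s : seq 'I_k :=
  [seq x <- enum 'I_k | (x \in a) &&
     [forall y, (y \in porbit s x) ==> (x <= y)%N]].

Lemma other_mins_setC s i : other_mins s i = cycle_mins (~: porbit s i) s.
Proof. by apply: eq_filter => x; rewrite in_setC. Qed.

(** There are at most [k] cycles, so the natural subtraction in [cyc_sign] does not truncate and its
    parity is that of [s]. *)
Lemma cyc_signE s : cyc_sign R s = (-1) ^+ s.
Proof.
have le_k : (#|porbits s| <= k)%N.
  by rewrite -[leqRHS](card_ord k); apply: leq_imset_card.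
by rewrite /cyc_sign -signr_odd oddB // /odd_perm card_ord.
Qed.

(** The weight sees only the action of [s] on [a], so altering [s] inside the cycle of [i] does not
    change the weight of the other cycles. *)
Definition local_weight (w : {set 'I_k} -> 'S_k -> H) :=
  forall a s t, {in a, s =1 t} -> (forall y, y \in a -> t y \in a) ->
  w a s = w a t.

Section Weight.
Variable w : {set 'I_k} -> 'S_k -> H.

Definition wdet a : H := \sum_(s : 'S_k | perm_on a s) (-1) ^+ s * w a s.

(* The factor [F j i] closing the cycle of [i] is omitted from the product, and
   [w] weights the cycles of [a] avoiding [i]. *)
Definition wcof a : 'M[H]_k := \matrix_(i, j)
  if i \in a then
    \sum_(s : 'S_k | perm_on a s && (s j == i))
       (-1) ^+ s * (w (a :\: porbit s i) s * openprod s i)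
  else 0.

Lemma wcof_outl a i j : i \notin a -> wcof a i j = 0.
Proof. by rewrite mxE => /negPf->. Qed.

Lemma wcof_outr a i j : j \notin a -> wcof a i j = 0.
Proof.
move=> aj; rewrite mxE; case: ifP => // ai; rewrite big_pred0 // => s.
apply/negP=> /andP[a_s /eqP sj].
by move: aj; rewrite -(perm_closed _ a_s) sj ai.
Qed.

(** Permutations are grouped by the preimage [j] of [i]. An arbitrary [f] covers both multiplication
    by [F] and a replaced column. *)
Lemma wcof_sum a i (f : 'I_k -> H) : i \in a ->
  \sum_j wcof a i j * f j =
  \sum_(s : 'S_k | perm_on a s)
     (-1) ^+ s * (w (a :\: porbit s i) s * (openprod s i * f (s^-1%g i))).
Proof.
move=> ai; rewrite (partition_big (fun s => s^-1%g i) predT) //=.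
apply: eq_bigr => j _; rewrite mxE ai mulr_suml; apply: eq_big => [s|s].
  by rewrite (can2_eq (permK s) (permKV s)) eq_sym.
by move=> /andP[_ /eqP <-]; rewrite permK !mulrA.
Qed.

Lemma wcof_diag a i : i \in a -> wcof a i i = wdet (a :\ i).
Proof.
move=> ai; rewrite mxE ai; apply: eq_big => [s|s /andP[_ /eqP si]].
  apply/andP/idP => [[a_s /eqP si]|a_s].
    apply/subsetP=> x nx; rewrite in_setD1 (subsetP a_s _ nx) andbT.
    by apply: contraTneq nx => ->; rewrite inE si eqxx.
  split; first exact: subset_trans a_s (subsetDl _ _).
  by rewrite (out_perm a_s) // setD11.
have fix_i : porbit s i = [set i].
  apply/setP=> x; rewrite inE; apply/porbitP/eqP => [[n ->]|->].
    exact: permX_fix.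
  by exists 0%N; rewrite perm1.
by rewrite /openprod fix_i cards1 big_ord0 mulr1.
Qed.

Hypothesis w_local : local_weight w.

Lemma wcof_off a i j : j \in a -> i != j ->
  wcof a i j = - (wcof (a :\ j) *m F) i j.
Proof.
move=> aj ij; have [ai|ai] := boolP (i \in a); last first.
  rewrite wcof_outl // mxE big1 ?oppr0 // => l _.
  by rewrite wcof_outl ?mul0r // in_setD1 (negPf ai) andbF.
rewrite [in RHS]mxE wcof_sum ?in_setD1 ?ij // mxE ai -sumrN.
(* [s |-> s * tperm i j] inserts [j] at the end of the cycle of [i]. *)
rewrite (reindex_inj (mulIg (tperm i j))) /=; apply: eq_big => [s|s].
  rewrite permM; have [sj|sj] := eqVneq (s j) j.
    by rewrite sj tpermR eqxx andbT perm_on_insert.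
  transitivity false.
    apply/negP=> /andP[_ /eqP /(canRL (@tpermK _ i j))]; rewrite tpermL.
    by move/eqP; rewrite (negPf sj).
  apply/esym/negP=> a_s; have := out_perm a_s (negbT (setD11 _ _)).
  by move/eqP; rewrite (negPf sj).
rewrite permM => /andP[a_s /eqP sji].
have sj : s j = j by rewrite -[s j](tpermK i j) sji tpermL.
rewrite odd_permM odd_tperm ij signr_addb expr1 mulrN1 mulNr; congr (- (_ * _)).
rewrite (w_local (t := s)); first last.
- move=> y /setDP[ay ys].
  by rewrite -(eq_insert ij sj ys) in_setD porbit_step ys perm_closed.
- by move=> y /setDP[_ ys]; rewrite (eq_insert ij sj ys).
rewrite porbit_insert // setDDl; congr (_ * _).
(* Inserting [j] adds one factor to the open product, [F (s^-1 i) j], which is the entry of [F]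
   occurring in the matrix product. *)
rewrite /openprod porbit_insert // cardsU1 notin_porbit_insert // add1n succnK.
rewrite -(iter_porbit_pred s i); case def_m: #|porbit s i| => [|m].
  by have := card_porbit_neq0 s i; rewrite def_m.
rewrite big_ord_recr /= -iterS -def_m iter_insert_last //.
rewrite iter_insert ?def_m //; congr (_ * _); apply: eq_bigr => n _.
have lt_n : (n.+1 < #|porbit s i|)%N by rewrite def_m ltnS.
congr (F _ _); first exact: (iter_insert ij sj (ltnW lt_n)).
exact: (iter_insert ij sj lt_n).
Qed.

End Weight.

Definition ordered_weight a s : H :=
  \prod_(x <- rev (cycle_mins a s)) cycprod F s x.
Definition real_weight a s : H :=
  qreal (\prod_(x <- cycle_mins a s) q0 (cycprod F s x)).

Lemma eq_cycle_mins a s t : {in a, s =1 t} ->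
  (forall y, y \in a -> t y \in a) -> cycle_mins a s = cycle_mins a t.
Proof.
move=> eq_st at_a; apply: eq_filter => x; case: (boolP (x \in a)) => //= ax.
by rewrite (eq_porbit_iter (eq_in_iter_perm eq_st at_a ax)).
Qed.

Lemma eq_cycprod a s t x : {in a, s =1 t} ->
  (forall y, y \in a -> t y \in a) -> x \in a ->
  cycprod F s x = cycprod F t x.
Proof.
move=> eq_st at_a ax; have eq_it := eq_in_iter_perm eq_st at_a ax.
rewrite /cycprod (eq_porbit_iter eq_it); apply: eq_bigr => n _.
by rewrite !eq_it.
Qed.

Lemma ordered_weight_local : local_weight ordered_weight.
Proof.
move=> a s t eq_st at_a; rewrite /ordered_weight (eq_cycle_mins eq_st at_a).
apply: eq_big_seq => x; rewrite mem_rev mem_filter => /andP[/andP[ax _] _].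
exact: eq_cycprod ax.
Qed.

Lemma real_weight_local : local_weight real_weight.
Proof.
move=> a s t eq_st at_a; rewrite /real_weight (eq_cycle_mins eq_st at_a).
congr (qreal _); apply: eq_big_seq => x.
rewrite mem_filter => /andP[/andP[ax _] _].
by rewrite (eq_cycprod eq_st at_a ax).
Qed.

End Cofactors.

(** * Cofactor expansion, and agreement of both weights for Hermitian matrices *)

Section CofactorExpansion.
Variables (R : realFieldType) (k : nat) (F : 'M[quat R]_k).
Local Notation H := (quat R).
Implicit Types (s t : 'S_k) (a b : {set 'I_k}) (i j x : 'I_k).

Lemma wcof_mul_diag w a i : i \in a ->
  (wcof F w a *m F) i i =
  \sum_(s : 'S_k | perm_on a s)
     (-1) ^+ s * (w (a :\: porbit s i) s * cycprod F s i).
Proof.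
by move=> ai; rewrite mxE wcof_sum //; apply: eq_bigr => s _; rewrite cycprodE.
Qed.

Lemma in_cycle_mins a s x : (x \in cycle_mins a s) =
  (x \in a) && [forall y, (y \in porbit s x) ==> (x <= y)%N].
Proof. by rewrite mem_filter mem_enum andbT. Qed.

Lemma mem_cycle_mins a s i m : perm_on a s -> i \in a ->
  m \in porbit s i -> (forall y, y \in porbit s i -> (m <= y)%N) ->
  cycle_mins a s =i m :: cycle_mins (a :\: porbit s i) s.
Proof.
move=> a_s ai m_i min_m x; rewrite in_cons !in_cycle_mins in_setD.
have [x_i|x_i] := boolP (x \in porbit s i); last first.
  by case: (x =P m) => [xm|//]; move: x_i; rewrite xm m_i.
rewrite (subsetP (porbit_sub a_s ai) _ x_i) orbF /=.
have -> : porbit s x = porbit s i by apply/eqP; rewrite eq_porbit_mem.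
apply/forall_inP/eqP => [min_x|-> y]; last exact: min_m.
by apply/val_inj/anti_leq; rewrite min_x ?min_m.
Qed.

Lemma uniq_cycle_mins_cons a s i m : m \in porbit s i ->
  uniq (m :: cycle_mins (a :\: porbit s i) s).
Proof.
move=> m_i; rewrite /= filter_uniq ?enum_uniq // andbT.
by rewrite in_cycle_mins in_setD m_i.
Qed.

(** Both lists are strictly increasing with the same members, hence equal as lists; ordered products
    need this, not just a permutation. *)
Lemma cycle_mins_cons a s i : perm_on a s -> i \in a ->
  (forall y, y \in a -> (i <= y)%N) ->
  cycle_mins a s = i :: cycle_mins (a :\: porbit s i) s.
Proof.
move=> a_s ai min_i.
have lt_trans : transitive (fun x y : 'I_k => (x < y)%N).
  by move=> y x z; apply: ltn_trans.
have sorted_mins b : sorted (fun x y : 'I_k => (x < y)%N) (cycle_mins b s).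
  apply: sorted_filter => //; have := iota_ltn_sorted 0 k.
  by rewrite -val_enum_ord sorted_map.
apply: (irr_sorted_eq lt_trans) => // [x||].
- exact: ltnn.
- rewrite [sorted _ _]path_sortedE // sorted_mins andbT.
  apply/allP=> x; rewrite in_cycle_mins in_setD => /andP[/andP[x_i ax] _].
  rewrite ltn_neqAle min_i // andbT; apply: contraNneq x_i => /val_inj <-.
  exact: porbit_id.
apply: mem_cycle_mins => // [|y yi]; first exact: porbit_id.
exact/min_i/(subsetP (porbit_sub a_s ai)).
Qed.

Lemma q0_cycprod_step s x : q0 (cycprod F s (s x)) = q0 (cycprod F s x).
Proof.
have orb : porbit s (s x) = porbit s x.
  by rewrite -[s x]/((s ^+ 1)%g x) porbit_perm.
rewrite /cycprod orb; have := iter_porbit s x.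
case: #|porbit s x| (card_porbit_neq0 s x) => // m _ it.
rewrite big_ord_recr big_ord_recl q0M /= -!iterSr it; congr (q0 (_ * _)).
by apply: eq_bigr => n _; rewrite -!iterS -!iterSr.
Qed.

Lemma q0_cycprod s x y : y \in porbit s x ->
  q0 (cycprod F s y) = q0 (cycprod F s x).
Proof.
move=> /porbitP[n ->]; elim: n => [|n IHn]; first by rewrite perm1.
by rewrite expgSr permM q0_cycprod_step.
Qed.

Definition hcof a : 'M[H]_k := wcof F (real_weight F) a.

Definition hdet a : R := \sum_(s : 'S_k | perm_on a s)
  (-1) ^+ s * \prod_(x <- cycle_mins a s) q0 (cycprod F s x).

Lemma wdet_real a : wdet (real_weight F) a = qreal (hdet a).
Proof.
rewrite rmorph_sum; apply: eq_bigr => s _.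
by rewrite rmorphM rmorph_sign.
Qed.

Lemma hcof_diag a i : i \in a -> hcof a i i = qreal (hdet (a :\ i)).
Proof. by move=> ai; rewrite /hcof wcof_diag // wdet_real. Qed.

Lemma hcof_off a i j : j \in a -> i != j ->
  hcof a i j = - (hcof (a :\ j) *m F) i j.
Proof. by apply: wcof_off; apply: real_weight_local. Qed.

(** The cycle through [i] enters as a product started at [i]; its real part is the same when started
    at the minimum [m] of the cycle, which restores the missing leader. *)
Lemma q0_hcof_mul a i : i \in a -> q0 ((hcof a *m F) i i) = hdet a.
Proof.
move=> ai; rewrite wcof_mul_diag // raddf_sum; apply: eq_bigr => s a_s.
rewrite -(rmorph_sign (@qreal R)) [LHS]q0_realM q0_realM; congr (_ * _).
case: (arg_minnP (fun y : 'I_k => y : nat) (porbit_id s i)) => m m_i min_m.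
rewrite [RHS](perm_big (m :: cycle_mins (a :\: porbit s i) s)); last first.
  apply: uniq_perm; [by rewrite filter_uniq ?enum_uniq | | ].
    exact: uniq_cycle_mins_cons.
  exact: mem_cycle_mins.
by rewrite big_cons mulrC (q0_cycprod m_i).
Qed.

(** For the least [i] in [a], the cycle of [i] comes last in the decreasing order of leaders,
    exactly where the expansion at [i] puts it. *)
Lemma wdet_ordered_weight a i : i \in a -> (forall y, y \in a -> (i <= y)%N) ->
  wdet (ordered_weight F) a = (wcof F (ordered_weight F) a *m F) i i.
Proof.
move=> ai min_i; rewrite wcof_mul_diag //; apply: eq_bigr => s a_s.
by rewrite /ordered_weight (cycle_mins_cons a_s ai min_i) rev_cons big_rcons.
Qed.

Lemma hdet0 : hdet set0 = 1.
Proof.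
rewrite /hdet (big_pred1 1%g) => [|s].
  rewrite odd_perm1 mul1r /cycle_mins big_filter big_pred0 // => x.
  by rewrite inE.
apply/idP/eqP => [s0|->]; last exact: perm_on1.
by apply: perm_on_id s0 _; rewrite cards0.
Qed.

Hypothesis F_herm : ctmx F = F.

Let F_conj i j : qconj (F i j) = F j i.
Proof. by rewrite -[in RHS]F_herm ctmxE. Qed.

Lemma mul_hcof_out a i l : i \notin a -> (F *m hcof a) l i = 0.
Proof.
move=> ai; rewrite mxE big1 // => x _.
by rewrite [hcof _ _ _]wcof_outr ?mulr0.
Qed.

Lemma hcof_mul_out a i l : i \notin a -> (hcof a *m F) i l = 0.
Proof.
move=> ai; rewrite mxE big1 // => x _.
by rewrite [hcof _ _ _]wcof_outl ?mul0r.
Qed.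

(** With G the cofactor matrix and d the determinant of [a] without [i] and [j], both sides reduce
    to [(F *m G *m F) i j - d * F i j]: the left by [hcof_off] then induction, the right by
    [hcof_off] alone. The real d commutes with [F i j]. *)
Lemma hcof_offl a i j : i \in a -> i != j ->
  hcof a i j = - (F *m hcof (a :\ i)) i j.
Proof.
have [n] := ubnP #|a|; elim: n a i j => // n IHn a i j le_n ai ij.
have [aj|aj] := boolP (j \in a); last first.
  rewrite [LHS]wcof_outr // mul_hcof_out ?oppr0 //.
  by rewrite in_setD1 (negPf aj) andbF.
rewrite hcof_off // !mxE (bigD1 i) // [in RHS](bigD1 j) //=.
rewrite hcof_diag ?in_setD1 ?ij // hcof_diag ?in_setD1 1?eq_sym ?ij //.
rewrite setDDl setUC -setDDl qreal_comm; congr (- (_ + _)).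
rewrite (eq_bigr (fun l => - ((F *m hcof (a :\ j :\ i)) i l * F l j))).
  rewrite [RHS](eq_bigr (fun l => - (F i l * (hcof (a :\ i :\ j) *m F) l j))).
    rewrite !sumrN; congr (- _).
    transitivity ((F *m hcof (a :\ j :\ i) *m F) i j).
      by rewrite [RHS]mxE [RHS](bigD1 i) //= mul_hcof_out ?setD11 // mul0r add0r.
    rewrite -mulmxA mxE (bigD1 j) //= hcof_mul_out ?mulr0 ?add0r.
      by rewrite setDDl setUC -setDDl.
    by rewrite !inE eqxx andbF.
  by move=> l lj; rewrite hcof_off ?mulrN // in_setD1 eq_sym ij.
move=> l li; rewrite IHn ?mulNr ?in_setD1 ?ij // 1?eq_sym //.
by rewrite (cardsD1 j) aj in le_n.
Qed.

(** Conjugate transposition exchanges the right recursion [hcof_off] with the left one [hcof_offl],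
    so induction applies. *)
Lemma hcof_ctmx a : ctmx (hcof a) = hcof a.
Proof.
have [n] := ubnP #|a|; elim: n a => // n IHn a le_n.
apply/matrixP=> i j; rewrite ctmxE.
have [ai|ai] := boolP (i \in a); last first.
  by rewrite [hcof a j i]wcof_outr // [RHS]wcof_outl // raddf0.
have [<-|ij] := eqVneq i j; first by rewrite hcof_diag // qconj_real.
rewrite hcof_off 1?eq_sym // hcof_offl // raddfN /= -ctmxE ctmxM F_herm IHn //.
by rewrite (cardsD1 i) ai in le_n.
Qed.

(** Only cofactors of the smaller set [a :\ i] remain: the term [l = i] is diagonal, and the left
    recursion rewrites the others. *)
Lemma hcof_mul_schur a i j : i \in a ->
  (hcof a *m F) i j =
  qreal (hdet (a :\ i)) * F i j - (F *m hcof (a :\ i) *m F) i j.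
Proof.
move=> ai; rewrite mxE (bigD1 i) //= hcof_diag //; congr (_ + _).
rewrite [X in - X]mxE [in RHS](bigD1 i) //= mul_hcof_out ?setD11 //.
rewrite mul0r add0r.
by rewrite -sumrN; apply: eq_bigr => l li; rewrite hcof_offl 1?eq_sym // mulNr.
Qed.

Lemma hcof_mul a i j : i \in a -> j \in a ->
  (hcof a *m F) i j = (if i == j then qreal (hdet a) else 0).
Proof.
have [n] := ubnP #|a|; elim: n a i j => // n IHn a i j le_n ai aj.
have [<-|ij] := eqVneq i j.
  (* The Schur-type formula shows that the entry is real, and its real part
     is [hdet a] by construction. *)
  rewrite -(q0_hcof_mul ai); apply: qconj_fixed.
  rewrite hcof_mul_schur // raddfB /= qconjM F_conj qconj_real -qreal_comm.
  by rewrite -ctmxE !ctmxM F_herm hcof_ctmx mulmxA.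
(* By induction only the term [l = j] survives in the subtracted product, and it cancels the first
   term because [hdet] is real. *)
rewrite hcof_mul_schur // -mulmxA [in X in _ - X]mxE (bigD1 j) //= big1.
  rewrite IHn ?eqxx ?in_setD1 1?eq_sym ?ij //.
    by rewrite addr0 qreal_comm subrr.
  by rewrite (cardsD1 i) ai in le_n.
move=> l lj; have [al|al] := boolP (l \in a :\ i).
  rewrite IHn ?(negPf lj) ?mulr0 ?al ?in_setD1 1?[j == i]eq_sym ?ij //.
  by rewrite (cardsD1 i) ai in le_n.
by rewrite hcof_mul_out ?mulr0.
Qed.

(** Joint induction: the cofactors of [a] depend on smaller sets only, and the determinant of [a] is
    then read off the expansion at the least element of [a]. *)
Lemma ordered_cofactors a :
  wcof F (ordered_weight F) a = hcof a /\
  wdet (ordered_weight F) a = qreal (hdet a).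
Proof.
have [n] := ubnP #|a|; elim: n a => // n IHn a le_n.
have eq_cof : wcof F (ordered_weight F) a = hcof a.
  apply/matrixP=> i j; have [aj|aj] := boolP (j \in a); last first.
    by rewrite wcof_outr // [RHS]wcof_outr.
  have le_j : (#|a :\ j| < n)%N by rewrite (cardsD1 j) aj in le_n.
  have [eq_ij|ij] := eqVneq i j.
    by rewrite eq_ij [LHS]wcof_diag // hcof_diag //; case: (IHn _ le_j).
  rewrite [LHS](wcof_off F (ordered_weight_local F)) // hcof_off //.
  by have [-> _] := IHn _ le_j.
split=> //; have [->|[i0 ai0]] := set_0Vmem a.
  rewrite -wdet_real; apply: eq_bigr => s _; congr (_ * _).
  have mins0 : cycle_mins set0 s = [::].
    rewrite /cycle_mins -(filter_pred0 (enum 'I_k)).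
    by apply: eq_filter => x; rewrite inE.
  by rewrite /ordered_weight /real_weight mins0 !big_nil.
case: (arg_minnP (fun y : 'I_k => y : nat) ai0) => i ai min_i.
by rewrite (wdet_ordered_weight ai min_i) eq_cof hcof_mul // eqxx.
Qed.

End CofactorExpansion.

(** * Row and column determinants of Hermitian matrices *)

Section RowColumnDeterminants.
Variables (R : realFieldType) (k : nat).
Local Notation H := (quat R).
Implicit Types (F : 'M[H]_k) (s : 'S_k) (a b : {set 'I_k}) (i j x : 'I_k).

(** Column [i] is met once per permutation, in the rightmost factor closing the cycle of [i];
    meeting it earlier would mean a premature return to [i]. *)
Lemma cdet_colrep F i (c : 'cV[H]_k) : cdet i (colrep F i c) =
  (wcof F (ordered_weight F) setT *m c) i 0.
Proof.
have eq_mins s x : x \in rev (other_mins s i) ->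
    cycprod (colrep F i c) s x = cycprod F s x.
  rewrite mem_rev mem_filter => /andP[/andP[x_i _] _].
  apply: eq_bigr => n _; rewrite mxE; case: eqP => // it_i.
  by case/negP: x_i; rewrite porbit_sym -it_i -permX mem_porbit.
have eq_i s : cycprod (colrep F i c) s i = openprod F s i * c (s^-1%g i) 0.
  rewrite cycprodE [colrep F i c _ i]mxE eqxx; congr (_ * _).
  apply: eq_bigr => n _; rewrite mxE; case: eqP => // it_i.
  case: n it_i => n lt_n /= it_i; have := uniq_traject_porbit s i.
  case: #|porbit s i| lt_n => //= m lt_n /andP[/negP[]].
  by rewrite -[X in X \in _]it_i; apply/trajectP; exists n; rewrite // -iterSr.
rewrite mxE wcof_sum ?in_setT //; apply: eq_big => [s|s _].
  by apply/esym/subsetP=> x _; rewrite inE.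
rewrite cyc_signE eq_i (eq_big_seq _ (eq_mins s)) /ordered_weight setTD.
by rewrite -(other_mins_setC s i).
Qed.

(** Conjugation reverses the order of the factors, and the inverse permutation runs through the
    cycle backwards. *)
Lemma cycprodV F s x : cycprod F s^-1 x = qconj (cycprod (ctmx F) s x).
Proof.
rewrite /cycprod porbitV.
rewrite (qconj_prod_ord _ (fun n => ctmx F (iter n s x) (iter n.+1 s x))).
apply: eq_bigr => n _; rewrite ctmxE qconjK.
have it p : (p <= #|porbit s x|)%N ->
    iter p s^-1%g x = iter (#|porbit s x| - p) s x.
  move=> le_p; rewrite -{1}(iter_porbit s x) -{1}(subnKC le_p) iterD.
  by elim: p {le_p} (iter _ s x) => // p IHp z; rewrite iterSr iterS permK.
by rewrite !it ?subnSK // ltnW.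
Qed.

(** The sum is reindexed by inversion, which keeps the cycles and their leaders; conjugation turns
    decreasing leaders into increasing ones. *)
Lemma rdet_cdet F i : rdet i F = qconj (cdet i (ctmx F)).
Proof.
rewrite /cdet raddf_sum /rdet (reindex_inj invg_inj) /=; apply: eq_bigr => s _.
rewrite !cyc_signE odd_permV !qconjM cycprodV -(rmorph_sign (@qreal R)).
rewrite qconj_real -qreal_comm.
rewrite [qconj (\prod_(x <- rev _) _)]qconj_prod revK; congr (_ * (_ * _)).
rewrite !other_mins_setC porbitV.
have -> : cycle_mins (~: porbit s i) s^-1 = cycle_mins (~: porbit s i) s.
  by apply: eq_filter => x; rewrite porbitV.
by apply: eq_bigr => x _; rewrite cycprodV.
Qed.

Lemma cdet_herm F i : ctmx F = F -> cdet i F = qreal (hdet F setT).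
Proof.
move=> F_herm; have -> : cdet i F = cdet i (colrep F i (col i F)).
  by congr cdet; apply/matrixP=> u v; rewrite !mxE; case: eqP => // ->.
rewrite cdet_colrep (proj1 (ordered_cofactors F_herm _)) colE mulmxA -colE mxE.
by rewrite hcof_mul ?in_setT // eqxx.
Qed.

Lemma qdet_herm F : ctmx F = F -> qdet F = qreal (hdet F setT).
Proof.
move=> F_herm; rewrite /qdet; case: pickP => [i _|no_i].
  by rewrite rdet_cdet F_herm cdet_herm // qconj_real.
(* For the empty matrix the default value 1 of [qdet] is the sum over the identity alone. *)
have -> : [set: 'I_k] = set0 by apply/setP=> i; have := no_i i.
by rewrite hdet0.
Qed.

End RowColumnDeterminants.

(** * Cofactors and determinants of principal submatrices *)

Section PrincipalSubmatrix.
Variables (R : realFieldType) (k : nat) (F : 'M[quat R]_k).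
Hypothesis F_herm : ctmx F = F.
Implicit Types (b : {set 'I_k}) (i : 'I_k).

Lemma ctmx_psubmx b : ctmx (psubmx F b) = psubmx F b.
Proof. by apply/matrixP=> u v; rewrite ctmxE !mxE -ctmxE F_herm. Qed.

Lemma sum_enum_val b (f : 'I_k -> quat R) : (forall x, x \notin b -> f x = 0) ->
  \sum_x f x = \sum_(u < #|b|) f (enum_val u).
Proof.
move=> f0; rewrite (bigID (mem b)) /= addrC big1 ?add0r //; exact: big_enum_val.
Qed.

(** No permutation is carried from one index type to the other: both sides obey the same recursions,
    so induction on [#|a|] suffices. *)
Lemma psubmx_cofactors b (a : {set 'I_#|b|}) :
  (forall u v, hcof (psubmx F b) a u v =
     hcof F (enum_val @: a) (enum_val u) (enum_val v)) /\
  hdet (psubmx F b) a = hdet F (enum_val @: a).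
Proof.
have [n] := ubnP #|a|; elim: n a => // n IHn a le_n.
have inj_ev : injective (enum_val : 'I_#|b| -> 'I_k) := enum_val_inj.
have imD v : enum_val @: (a :\ v) = (enum_val @: a) :\ enum_val v.
  apply/setP=> x; rewrite in_setD1.
  apply/imsetP/andP => [[w /setD1P[wv aw] ->]|[xv /imsetP[w aw xw]]].
    by rewrite (inj_eq inj_ev) mem_imset.
  exists w => //; rewrite in_setD1 aw andbT; apply: contraNneq xv => <-.
  exact/eqP.
have eq_cof u v : hcof (psubmx F b) a u v =
    hcof F (enum_val @: a) (enum_val u) (enum_val v).
  have [av|av] := boolP (v \in a); last first.
    by rewrite [LHS]wcof_outr // [RHS]wcof_outr // mem_imset.
  have le_v : (#|a :\ v| < n)%N by rewrite (cardsD1 v) av in le_n.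
  have [cof_v det_v] := IHn _ le_v.
  have [->|uv] := eqVneq u v.
    by rewrite hcof_diag // hcof_diag ?mem_imset // det_v imD.
  rewrite hcof_off // hcof_off ?mem_imset ?(inj_eq inj_ev) // !mxE.
  congr (- _); rewrite [RHS](sum_enum_val (b := b)).
    by apply: eq_bigr => w _; rewrite cof_v imD [psubmx _ _ _ _]mxE.
  move=> x bx; rewrite [hcof _ _ _ _]wcof_outr ?mul0r // in_setD1 negb_and.
  by apply/orP; right; apply: contra bx => /imsetP[w _ ->]; apply: enum_valP.
split=> //; have [->|[u au]] := set_0Vmem a; first by rewrite imset0 !hdet0.
apply: (@qreal_inj R).
have := hcof_mul (ctmx_psubmx b) au au; rewrite eqxx => <-.
have au' : enum_val u \in [set enum_val w | w in a] by rewrite mem_imset.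
have := hcof_mul F_herm au' au'; rewrite eqxx => <-.
rewrite !mxE [RHS](sum_enum_val (b := b)).
  by apply: eq_bigr => w _; rewrite eq_cof [psubmx _ _ _ _]mxE.
move=> x bx; rewrite [hcof _ _ _ _]wcof_outr ?mul0r //.
by apply: contra bx => /imsetP[w _ ->]; apply: enum_valP.
Qed.

Lemma imset_enum_val b : enum_val @: [set: 'I_#|b|] = b.
Proof.
apply/setP=> x; apply/imsetP/idP => [[u _ ->]|bx]; first exact: enum_valP.
by exists (enum_rank_in bx x); rewrite ?enum_rankK_in.
Qed.

Lemma det_sub_herm b : det_sub F b = qreal (hdet F b).
Proof.
rewrite /det_sub qdet_herm ?ctmx_psubmx // (proj2 (psubmx_cofactors _)).
by rewrite imset_enum_val.
Qed.

Lemma cdet_sub_colrep b i (c : 'cV[quat R]_k) : i \in b ->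
  cdet_sub i (colrep F i c) b = (hcof F b *m c) i 0.
Proof.
move=> bi; rewrite /cdet_sub; case: pickP => [u /eqP ui|/(_ (enum_rank_in bi i))].
  have -> : psubmx (colrep F i c) b =
      colrep (psubmx F b) u (\col_v c (enum_val v) 0).
    by apply/matrixP=> v w; rewrite !mxE -ui (inj_eq enum_val_inj).
  rewrite cdet_colrep (proj1 (ordered_cofactors (ctmx_psubmx b) _)) !mxE.
  rewrite [RHS](sum_enum_val (b := b)) => [|x bx]; last first.
    by rewrite [hcof _ _ _ _]wcof_outr ?mul0r.
  apply: eq_bigr => w _; rewrite (proj1 (psubmx_cofactors _)) imset_enum_val ui.
  by congr (_ * _); rewrite mxE.
by rewrite enum_rankK_in ?eqxx.
Qed.

End PrincipalSubmatrix.

Section RowReplacement.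
Variables (R : realFieldType) (k : nat) (F : 'M[quat R]_k).

Lemma rdet_sub_rowrep (b : {set 'I_k}) i (r : 'rV[quat R]_k) :
  rdet_sub i (rowrep F i r) b = qconj (cdet_sub i (colrep (ctmx F) i (ctmx r)) b).
Proof.
rewrite /rdet_sub /cdet_sub; case: pickP => [u _|_]; last by rewrite raddf0.
rewrite rdet_cdet; congr (qconj (cdet _ _)); apply/matrixP=> v w.
by rewrite !mxE; case: ifP.
Qed.

End RowReplacement.

(** * The Moore-Penrose inverse *)

Section CompoundCofactors.
Variables (R : realFieldType) (k : nat) (F : 'M[quat R]_k).
Local Notation H := (quat R).
Implicit Types (b : {set 'I_k}) (i j : 'I_k) (m : nat).

Definition sum_hcof m : 'M[H]_k := \sum_(b : {set 'I_k} | #|b| == m) hcof F b.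
Definition sum_hdet m : R := \sum_(b : {set 'I_k} | #|b| == m) hdet F b.

Lemma sum_hdet0 : sum_hdet 0 = 1.
Proof.
by rewrite /sum_hdet (big_pred1 set0) ?hdet0 // => b; rewrite cards_eq0.
Qed.

Lemma sum_hcof_out m : (k < m)%N -> sum_hcof m = 0.
Proof.
move=> lt_m; rewrite /sum_hcof big_pred0 // => b.
by apply/negbTE; rewrite neq_ltn (leq_ltn_trans (max_card _)) ?card_ord.
Qed.

Hypothesis F_herm : ctmx F = F.

(** [hcof F b *m F] is scalar only inside [b]; in a column [j] outside [b], the cofactors of
    [j |: b] supply the correction. *)
Lemma hcof_mulD b i j :
  (hcof F b *m F) i j + (if j \in b then 0 else hcof F (j |: b) i j) =
  if i == j then qreal (hdet F b) else 0.
Proof.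
have [bi|bi] := boolP (i \in b); last first.
  rewrite hcof_mul_out // add0r; have [<-|ij] := eqVneq i j.
    by rewrite (negPf bi) hcof_diag ?setU11 // setU1K.
  by case: ifP => // _; rewrite [hcof _ _ _ _]wcof_outl // in_setU1 (negPf ij).
have [bj|bj] := boolP (j \in b); first by rewrite addr0 hcof_mul.
have ij : i != j by apply: contraNneq bj => <-.
by rewrite (negPf ij) hcof_off ?setU11 // setU1K // addrN.
Qed.

(** Up to signs this is the Faddeev-LeVerrier recursion. In column [j], adding [j] matches the sets
    of size [m] avoiding [j] with the sets of size [m.+1] containing it. *)
Lemma sum_hcof_rec m :
  sum_hcof m *m F + sum_hcof m.+1 = (qreal (sum_hdet m))%:M.
Proof.
apply/matrixP=> i j; rewrite mxE mulmx_suml !summxE mxE rmorph_sum -sumrMnl.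
under [RHS]eq_bigr => b _ do rewrite mulrb -hcof_mulD.
rewrite big_split /=; congr (_ + _).
rewrite (bigID (fun b => j \in b)) /= [X in _ + X]big1 ?addr0; last first.
  by move=> b /andP[_ bj]; rewrite [hcof _ _ _ _]wcof_outr.
rewrite (reindex_onto (fun b => j |: b) (fun b => b :\ j)) /=; last first.
  by move=> b /andP[_ bj]; rewrite setD1K.
rewrite [RHS](bigID (fun b => j \in b)) /= [X in _ = X + _]big1 ?add0r; last first.
  by move=> b /andP[_ ->].
apply: eq_big => [b|b /andP[_ /eqP bE]]; last first.
  by case: ifP => // bj; have := setD11 j (j |: b); rewrite bE bj.
rewrite setU11 andbT; have [bj|bj] := boolP (j \in b).
  rewrite andbF; apply/negP=> /andP[_ /eqP bE].
  by have := setD11 j (j |: b); rewrite bE bj.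
by rewrite setU1K // eqxx cardsU1 bj.
Qed.

Lemma tr_sum_hcof m : q0 (\tr (sum_hcof m *m F)) = m%:R * sum_hdet m.
Proof.
rewrite /mxtrace raddf_sum.
under eq_bigr do rewrite mulmx_suml summxE raddf_sum.
rewrite exchange_big mulr_sumr; apply: eq_bigr => b /eqP <- /=.
rewrite (bigID (mem b)) /= [X in _ + X]big1 ?addr0; last first.
  by move=> i bi; rewrite hcof_mul_out.
rewrite (eq_bigr (fun=> hdet F b)) => [|i bi]; last exact: q0_hcof_mul.
by rewrite sumr_const mulr_natl.
Qed.

Lemma sum_hcof_mul_eq0 m :
  (forall l, (m <= l)%N -> sum_hdet l = 0) -> sum_hcof m *m F = 0.
Proof.
move: {2}(k.+1 - m)%N (leqnn (k.+1 - m)) => d.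
elim: d m => [|d IHd] m le_d e0.
  by rewrite sum_hcof_out ?mul0mx // -subn_eq0 -leqn0.
(* Writing P for [sum_hcof m], it suffices that [P *m F *m F = 0]; this is the recursion multiplied
   by [F], its other terms vanishing by induction and by [e0]. *)
apply: mulmx_ctmx_eq0; rewrite ctmxM F_herm.
have := sum_hcof_rec m; rewrite e0 // raddf0 => /(congr1 (mulmxr F)) /=.
have PF : sum_hcof m.+1 *m F = 0.
  apply: IHd => [|l /ltnW]; last exact: e0.
  by rewrite subnS; case: (_ - _)%N le_d.
by rewrite mulmxDl PF addr0 mul0mx mulmxA => ->; rewrite mul0mx.
Qed.

End CompoundCofactors.

Section MoorePenrose.
Variables (R : realFieldType) (p k : nat).
Variables (A : 'M[quat R]_(p, k)) (X : 'M[quat R]_(k, p)).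
Hypothesis AX : is_MP A X.
Local Notation F := (ctmx A *m A).

Let F_herm : ctmx F = F.
Proof. by rewrite ctmxM ctmxK. Qed.

Lemma sum_hcof_MP : exists2 m, sum_hdet F m != 0 &
  sum_hcof F m *m ctmx A = qreal (sum_hdet F m) *: X.
Proof.
have [AXA XAX AXs XAs] := AX.
have e_bound l : sum_hdet F l != 0 -> (l <= k)%N.
  apply: contra_neqT; rewrite -ltnNge => lt_k.
  rewrite /sum_hdet big_pred0 // => b.
  by apply/negbTE; rewrite neq_ltn (leq_ltn_trans (max_card _)) ?card_ord.
have e_ex : exists l, sum_hdet F l != 0.
  by exists 0%N; rewrite sum_hdet0 oner_eq0.
case: (ex_maxnP e_ex e_bound) => m em max_m; exists m => //.
have := sum_hcof_rec F_herm m => /(congr1 (mulmxr F)) /=.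
rewrite mulmxDl (sum_hcof_mul_eq0 F_herm (m := m.+1)) ?addr0 => [PFF|l lt_m].
  have AsE : ctmx A = F *m X.
    by rewrite -mulmxA -[in RHS]AXs -ctmxM AXA.
  (* Since [X *m A] is self-adjoint, [X = ctmx A *m ctmx X *m X]. Thus [F] factors out of [X] on the
     left, and [P *m F *m F = e *: F] can be applied to it. *)
  have XE : X = F *m (X *m (ctmx X *m X)).
    transitivity (ctmx A *m (ctmx X *m X)); last by rewrite {1}AsE -mulmxA.
    by rewrite mulmxA -ctmxM XAs XAX.
  transitivity (sum_hcof F m *m F *m X).
    by rewrite -(mulmxA (sum_hcof F m)) -AsE.
  rewrite [X in _ *m X = _]XE mulmxA PFF mul_scalar_mx -scalemxAl.
  by congr (_ *: _); rewrite -XE.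
by apply/eqP; apply: contraTT lt_m => /max_m; rewrite -leqNgt.
Qed.

Lemma sum_hcof_MP_rank r : q0 (\tr (X *m A)) = r%:R ->
  sum_hdet F r != 0 /\
  sum_hcof F r *m ctmx A = qreal (sum_hdet F r) *: X.
Proof.
move=> trXA; have [m em PA] := sum_hcof_MP.
suff -> : r = m by [].
(* The real trace of [sum_hcof F m *m F] is [m] times [sum_hdet F m] by counting and [r] times it by
   [PA]. *)
apply/eqP; rewrite -(eqr_nat R) -trXA; apply/eqP/(mulfI em).
by rewrite [RHS]mulrC -tr_sum_hcof mulmxA PA -scalemxAl mxtraceZ q0_realM.
Qed.

Lemma MP_mul_entry r q (C : 'M[quat R]_(p, q)) i j :
  q0 (\tr (X *m A)) = r%:R ->
  (X *m C) i j =
    (\sum_(b : {set 'I_k} | (#|b| == r) && (i \in b))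
        cdet_sub i (colrep F i (col j (ctmx A *m C))) b) *
    qinv (\sum_(b : {set 'I_k} | #|b| == r) det_sub F b).
Proof.
move=> trXA; have [er PA] := sum_hcof_MP_rank trXA.
rewrite [X in qinv X](eq_bigr (fun b => qreal (hdet F b))) => [|b _]; last first.
  exact: (det_sub_herm F_herm).
rewrite -rmorph_sum /= -/(sum_hdet F r) qinv_real.
rewrite (eq_bigr (fun b => (hcof F b *m (ctmx A *m C)) i j)); last first.
  move=> b /andP[_ bi].
  by rewrite (cdet_sub_colrep F_herm) // colE mulmxA -colE mxE.
(* Row [i] of [hcof F b] vanishes when [i] is not in [b], so the sum extends to all [b] of size
   [r]. *)
rewrite big_mkcondr /= (eq_bigr (fun b => (hcof F b *m (ctmx A *m C)) i j)); last first.
  move=> b _; case: ifP => // /negbT bi; rewrite mxE big1 // => l _.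
  by rewrite [hcof _ _ _ _]wcof_outl ?mul0r.
rewrite -summxE -mulmx_suml -/(sum_hcof F r) mulmxA PA -scalemxAl [in RHS]mxE.
by rewrite -qreal_comm mulrA -rmorphM mulVf // mul1r.
Qed.

End MoorePenrose.

(** * The rank as the real trace of a projection *)

Section Rank.
Variables (R : realFieldType) (p k : nat).
Variables (A : 'M[quat R]_(p, k)) (X : 'M[quat R]_(k, p)).

(** With [S] a maximal independent set of columns, [W] writes every column of [A] through those in
    [S]. Then [W *m X *m A] has the same real trace as [X *m A], has zero rows off [S], and has
    diagonal entry 1 on [S]. *)
Lemma tr_MP r : has_rank A r -> is_MP A X -> q0 (\tr (X *m A)) = r%:R.
Proof.
move=> [[S [cardS indS]] maxS] [AXA _ _ _].
have [W AW W0] : exists2 W : 'M[quat R]_k, A *m W = A &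
    forall i j, i \notin S -> W i j = 0.
  have /choice[f fP] j : exists w : 'cV[quat R]_k,
      A *m w = col j A /\ forall i, i \notin S -> w i 0 = 0.
    have [jS|jS] := boolP (j \in S).
      exists (delta_mx j 0); rewrite -colE; split=> // i iS.
      by rewrite mxE andbT; case: eqP iS => // ->; rewrite jS.
    have /existsNP[v /not_implyP[vS /not_implyP[Av /eqP v0]]] :
        ~ col_indep A (j |: S).
      by move/maxS; rewrite cardsU1 jS cardS ltnn.
    have vj : v j 0 != 0.
      apply: contraNneq v0 => vj; apply/eqP/indS => // i iS.
      by have [->//|ij] := eqVneq i j; rewrite vS // in_setU1 negb_or ij.
    (* The dependency [v] is solved for column [j]. Scalars act on the right of columns, hence the
       inverse stands to the right of [v]. *)
    exists (delta_mx j 0 - v *m (qinv (v j 0))%:M); split=> [|i iS].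
      by rewrite mulmxBr mulmxA Av mul0mx subr0 -colE.
    rewrite !mxE big_ord1 !mxE mulr1n andbT.
    have [->|ij] := eqVneq i j; first by rewrite qmulV // subrr.
    by rewrite [v i _]vS ?mul0r ?subr0 // in_setU1 negb_or ij.
  exists (\matrix_(i, j) f j i 0) => [|i j iS]; last first.
    by rewrite mxE; apply: (proj2 (fP j)).
  apply/matrixP=> i j; have /matrixP/(_ i 0) := proj1 (fP j); rewrite !mxE => <-.
  by apply: eq_bigr => l _; rewrite mxE.
pose E := W *m X *m A.
have AE : A *m E = A by rewrite /E !mulmxA AW AXA.
have E0 i j : i \notin S -> E i j = 0.
  by move=> iS; rewrite /E -mulmxA mxE big1 // => l _; rewrite W0 ?mul0r.
rewrite -[in LHS]AW mulmxA q0_mxtraceM mulmxA -/E /mxtrace raddf_sum.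
rewrite (bigID (mem S)) /= [X in _ + X]big1 ?addr0 => [|i iS]; last first.
  by rewrite E0.
rewrite (eq_bigr (fun=> 1)) => [|j jS]; first by rewrite sumr_const cardS.
(* This difference is supported on [S] and killed by [A], so independence makes it zero. *)
have /matrixP/(_ j 0) : col j E - delta_mx j 0 = 0.
  apply: indS => [i iS|].
    rewrite mxE [col _ _ _ _]mxE E0 // !mxE andbT.
    by case: eqP iS => [->|_ _]; rewrite ?jS ?subrr.
  by rewrite mulmxBr -colE colE mulmxA AE -colE subrr.
by rewrite !mxE !eqxx => /eqP; rewrite subr_eq0 => /eqP->.
Qed.

End Rank.

(** * Row formulas by conjugate transposition *)

Section RowVersion.
Variables (R : realFieldType) (p k q : nat).
Variables (B : 'M[quat R]_(p, k)) (Y : 'M[quat R]_(k, p)) (C : 'M[quat R]_(q, k)).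
Local Notation F := (B *m ctmx B).

Lemma sum_det_sub_gram r :
  \sum_(a : {set 'I_p} | #|a| == r) det_sub F a = qreal (sum_hdet F r).
Proof.
rewrite rmorph_sum; apply: eq_bigr => a _; apply: det_sub_herm.
by rewrite ctmxM ctmxK.
Qed.

(** The column formula for [ctmx B], [ctmx Y], [ctmx C] is conjugated; the denominator is real, so
    it may return to the right. *)
Lemma mul_MP_entry r i j : is_MP B Y -> q0 (\tr (Y *m B)) = r%:R ->
  (C *m Y) i j =
    (\sum_(a : {set 'I_p} | (#|a| == r) && (j \in a))
        rdet_sub j (rowrep F j (row i (C *m ctmx B))) a) *
    qinv (\sum_(a : {set 'I_p} | #|a| == r) det_sub F a).
Proof.
move=> BY trYB; have trBY : q0 (\tr (ctmx Y *m ctmx B)) = r%:R.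
  rewrite -trYB q0_mxtraceM -ctmxM /mxtrace !raddf_sum.
  by apply: eq_bigr => l _; rewrite ctmxE.
have ctmx_row n (M : 'M[quat R]_(q, n)) : ctmx (row i M) = col i (ctmx M).
  by apply/matrixP=> u v; rewrite !mxE.
have := MP_mul_entry (is_MP_ctmx BY) (ctmx C) j i trBY.
rewrite ctmxK -ctmxM ctmxE => /(congr1 (@qconj R)).
rewrite qconjK => ->; rewrite sum_det_sub_gram qinv_real qconjM qconj_real.
rewrite qreal_comm raddf_sum; congr (_ * _); apply: eq_bigr => a _.
by rewrite rdet_sub_rowrep ctmx_row !ctmxM ctmxK.
Qed.

End RowVersion.

Theorem theorem5p2 (R : realType) (m n q s r1 r2 : nat)
  (A1 : 'M[quat R]_(m, n)) (B2 : 'M[quat R]_(q, s)) (C : 'M[quat R]_(m, s))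
  (A1d : 'M[quat R]_(n, m)) (B2d : 'M[quat R]_(s, q)) :
  has_rank A1 r1 -> has_rank B2 r2 ->
  is_MP A1 A1d -> is_MP B2 B2d ->
  let X1 := A1d *m C in
  let X2 := C *m B2d - (A1 *m A1d) *m C *m B2d in
  let C1 := ctmx A1 *m C in
  let C2 := C *m ctmx B2 in
  let AA := ctmx A1 *m A1 in
  let AAs := A1 *m ctmx A1 in
  let BB := B2 *m ctmx B2 in
  (forall (i : 'I_n) (j : 'I_s),
     X1 i j =
       (\sum_(b : {set 'I_n} | (#|b| == r1) && (i \in b))
           cdet_sub i (colrep AA i (col j C1)) b) *
       qinv (\sum_(b : {set 'I_n} | #|b| == r1) det_sub AA b))
  /\
  (forall (g : 'I_m) (f : 'I_q),
     X2 g f =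
       (\sum_(a : {set 'I_q} | (#|a| == r2) && (f \in a))
           rdet_sub f (rowrep BB f (row g C2)) a) *
       qinv (\sum_(a : {set 'I_q} | #|a| == r2) det_sub BB a)
     -
       (\sum_(l < m)
          (\sum_(a : {set 'I_m} | (#|a| == r1) && (l \in a))
              rdet_sub l (rowrep AAs l (row g AAs)) a) *
          (\sum_(a : {set 'I_q} | (#|a| == r2) && (f \in a))
              rdet_sub f (rowrep BB f (row l C2)) a)) *
       qinv ((\sum_(a : {set 'I_m} | #|a| == r1) det_sub AAs a) *
             (\sum_(a : {set 'I_q} | #|a| == r2) det_sub BB a))).
Proof.
move=> rkA rkB mpA mpB; have trA := tr_MP rkA mpA; have trB := tr_MP rkB mpB.
split=> [i j|g f]; first exact: MP_mul_entry.
rewrite mxE (mul_MP_entry C g f mpB trB) mxE.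
apply: (congr1 (fun x => _ - x)); rewrite -mulmxA mxE mulr_suml.
apply: eq_bigr => l _.
(* Entries of [A1 *m A1d] come from the row formula with [A1] also in the role of [C], so the
   replacing row is one of [A1 *m ctmx A1]. Both denominators are real and move to the right. *)
rewrite (mul_MP_entry A1 g l mpA trA) (mul_MP_entry C l f mpB trB).
rewrite !sum_det_sub_gram -rmorphM !qinv_real invfM rmorphM.
by rewrite !mulrA -(mulrA _ (qreal _)) qreal_comm !mulrA.
Qed.
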